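(* Let $F\subset\mathbb{R}^n$ be a (closed) halfspace. Then for any two integers $\tau>\sigma\ge1$ there exist $S\subset T\subset\mathbb{R}^n$, with $|S|=\sigma$ and $|T|=\tau$, such that $V_T(S)=F$.
   Context: For a finite nonempty set $T\subset\mathbb{R}^n$ and a nonempty proper subset $S\subset T$, the multipoint (higher order) Voronoi cell is $$V_T(S):=\left\{x\in\mathbb{R}^n : \max_{s\in S}\|x-s\|\le\min_{t\in T\setminus S}\|x-t\|\right\},$$ where $\|\cdot\|$ is the Euclidean norm. A halfspace is a set $\{x\in\mathbb{R}^n : \langle d,x\rangle\le\gamma\}$ with $d\in\mathbb{R}^n$, $\|d\|=1$, $\gamma\in\mathbb{R}$. *)

(* Defs.v *)
From HB Require Import structures.
From mathcomp Require Import all_boot all_order all_algebra finmap.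
From mathcomp Require Import boolp classical_sets reals constructive_ereal.

Set Implicit Arguments.
Unset Strict Implicit.
Unset Printing Implicit Defensive.

Import Order.TTheory GRing.Theory Num.Theory.

Local Open Scope classical_set_scope.
Local Open Scope ring_scope.

Definition dotv (R : realType) (n : nat) (u v : 'rV[R]_n) : R :=
  \sum_(i < n) u 0 i * v 0 i.

(* The norm [`|x|] that MathComp-Analysis puts on ['rV[R]_n] is the sup norm,
   so the Euclidean norm is defined here. *)
Definition enorm (R : realType) (n : nat) (x : 'rV[R]_n) : R :=
  Num.sqrt (dotv x x).

Definition halfspace (R : realType) (n : nat) (F : set 'rV[R]_n) : Prop :=
  exists (d : 'rV[R]_n) (gamma : R),
    enorm d = 1 /\ F = [set x | dotv d x <= gamma].

(* The maximum and minimum are taken in [\bar R]; the neutral elements -oo and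
   +oo matter only if [S], respectively [T `\` S], is empty, which is excluded
   when [S] is a nonempty proper subset of [T]. *)
Definition voronoi_cell (R : realType) (n : nat) (T S : {fset 'rV[R]_n}) :
    set 'rV[R]_n :=
  [set x | (\big[maxe/-oo]_(s <- S) (enorm (x - s)%R)%:E <=
            \big[mine/+oo]_(t <- (T `\` S)%fset) (enorm (x - t)%R)%:E)%E].

(* Main.v *)
(* All points are placed on the line spanned by the unit normal [d], at the
   equally spaced positions [gamma - sigma / 2 + i] for [i < tau], and [S]
   consists of the first [sigma] of them.  Points at positions [a < b] satisfy
   [|x - a d| <= |x - b d|] iff [<d, x> <= (a + b) / 2]; the tightest of these
   constraints comes from the smallest positions on each side, [i = 0] and
   [i = sigma], and reads [<d, x> <= gamma]. *)
Require Import Defs.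
From mathcomp Require Import all_boot all_order all_algebra finmap.
From mathcomp Require Import boolp classical_sets reals constructive_ereal.
From mathcomp Require Import ring lra.

Set Implicit Arguments.
Unset Strict Implicit.
Unset Printing Implicit Defensive.

Import Order.TTheory GRing.Theory Num.Theory.

Local Open Scope ring_scope.

Lemma dotv_subZ (R : realType) (n : nat) (d x : 'rV[R]_n) (a : R) :
  dotv (x - a *: d) (x - a *: d) =
  dotv x x - 2 * a * dotv d x + a ^+ 2 * dotv d d.
Proof.
rewrite /dotv !mulr_sumr -sumrB -big_split /=.
by apply: eq_bigr => i _; rewrite !mxE; ring.
Qed.

Lemma dotv_ge0 (R : realType) (n : nat) (x : 'rV[R]_n) : 0 <= dotv x x.
Proof. by apply: sumr_ge0 => i _; rewrite -expr2 sqr_ge0. Qed.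

Lemma dotv_unit (R : realType) (n : nat) (d : 'rV[R]_n) :
  enorm d = 1 -> dotv d d = 1.
Proof. by move=> d1; rewrite -(sqr_sqrtr (dotv_ge0 d)) -/(enorm d) d1 expr1n. Qed.

(** After squaring, [dotv x x] cancels and the difference of the two sides factors as [2 * (b - a)]
    times [(a + b) / 2 - dotv d x], with a positive first factor. *)
Lemma enorm_subZ_le (R : realType) (n : nat) (d x : 'rV[R]_n) (a b : R) :
  enorm d = 1 -> a < b ->
  (enorm (x - a *: d) <= enorm (x - b *: d)) = (dotv d x <= (a + b) / 2).
Proof.
move=> d1 ltab; rewrite /enorm ler_sqrt ?dotv_ge0 // !dotv_subZ !(dotv_unit d1) !mulr1.
rewrite -[LHS]subr_ge0 -[RHS]subr_ge0.
have -> : dotv x x - 2 * b * dotv d x + b ^+ 2 -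
    (dotv x x - 2 * a * dotv d x + a ^+ 2) =
    2 * (b - a) * ((a + b) / 2 - dotv d x) by field.
by rewrite pmulr_rge0 // mulr_gt0 ?subr_gt0.
Qed.

(** Removes the extended reals; the neutral elements keep this valid for empty index sets. *)
Lemma voronoi_cellP (R : realType) (n : nat) (T S : {fset 'rV[R]_n}) x :
  voronoi_cell T S x <->
  forall s t, s \in S -> t \in (T `\` S)%fset -> enorm (x - s) <= enorm (x - t).
Proof.
split=> [le_ST s t sS tT | le_ST].
  rewrite -lee_fin; apply: le_trans (le_trans le_ST _).
    exact: (le_bigmax_seq _ s xpredT (fun s => (enorm (x - s)%R)%:E)).
  exact: (ge_bigmin_seq _ t xpredT (fun t => (enorm (x - t)%R)%:E)).
rewrite /voronoi_cell /= big_seq; apply: bigmax_le => [|s sS].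
  exact: leNye.
rewrite big_seq; apply: le_bigmin => [|t tT]; first exact: leey.
by rewrite lee_fin le_ST.
Qed.

Theorem proposition3p6 (R : realType) (n : nat) (F : set 'rV[R]_n)
  (hF : halfspace F) (sigma tau : nat)
  (hsigma : (1 <= sigma)%N) (htau : (sigma < tau)%N) :
  exists S T : {fset 'rV[R]_n},
    [/\ (S `<=` T)%fset, #|` S|%fset = sigma, #|` T|%fset = tau
      & voronoi_cell T S = F].
Proof.
case: hF => d [gamma [d1 ->]].
pose c i : R := gamma - sigma%:R / 2 + i%:R.
pose p i := c i *: d.
have p_inj : injective p.
  (* Pairing with the unit vector [d] recovers the coefficient [c i]. *)
  move=> i j /(congr1 (dotv d)); rewrite /dotv.
  have dotdZ a : dotv d (a *: d) = a.
    rewrite -[RHS]mulr1 -(dotv_unit d1) /dotv mulr_sumr.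
    by apply: eq_bigr => k _; rewrite !mxE mulrCA.
  rewrite -!/(dotv _ _) !dotdZ => /addrI /eqP.
  by rewrite eqr_nat => /eqP.
pose P m := [fset x in map p (iota 0 m)]%fset.
have inP m x : reflect (exists2 i, (i < m)%N & x = p i) (x \in P m).
  rewrite !inE; apply: (iffP mapP) => -[i im ->]; exists i => //;
  by rewrite mem_iota in im *.
have pP m i : (p i \in P m) = (i < m)%N.
  by apply/inP/idP => [[j jm /p_inj ->//]|im]; exists i.
have cardP m : #|` P m|%fset = m.
  by rewrite card_fseq undup_id ?size_map ?size_iota // map_inj_uniq ?iota_uniq.
exists (P sigma), (P tau); split=> //.
  apply/fsubsetP => x /inP[i im ->].
  by rewrite pP (leq_trans im) // ltnW.
apply/seteqP; split=> x /=.
  (* One pair suffices: the shift by [sigma / 2] in [c] makes [gamma] the midpoint of [c 0] and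
     [c sigma]. *)
  move/voronoi_cellP/(_ (p 0%N) (p sigma)); rewrite inE !pP hsigma htau ltnn.
  rewrite enorm_subZ_le // /c ?lerD2l ?ltrD2l ?ltr_nat //.
  by move=> /(_ isT isT) /le_trans; apply; lra.
move=> le_x; apply/voronoi_cellP => s t /inP[i im ->].
rewrite inE => /andP[+ /inP[j _ tE]]; rewrite tE pP -leqNgt => sj.
rewrite enorm_subZ_le // /c ?ltrD2l ?ltr_nat ?(leq_trans im) //.
(* The midpoint of [c i] and [c j] is [gamma + (i + j - sigma) / 2], hence at least [gamma]. *)
have : (sigma%:R : R) <= j%:R by rewrite ler_nat.
have : (0 : R) <= i%:R by [].
by lra.
Qed.
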